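(* Let $\Lambda$ be a finite simplicial graph and let $W(\Lambda)$ be the associated right-angled Coxeter group. The number $\mathrm{cc}_2(W(\Lambda))$ of conjugacy classes of involutions in $W(\Lambda)$ is equal to the number of nontrivial cliques in $\Lambda$, i.e. of complete subgraphs of $\Lambda$ with at least one vertex.
   Context: For a finite simplicial graph $\Lambda$ with vertex set $V(\Lambda)$ and edge set $E(\Lambda)$, $W(\Lambda)=\langle V(\Lambda)\mid v^2\text{ for all }v\in V(\Lambda),\ (vw)^2\text{ for all }\{v,w\}\in E(\Lambda)\rangle$. An involution is an element of order exactly $2$. *)

(* Defs.v *)
From HB Require Import structures.
From mathcomp Require Import all_boot.
From mathcomp Require Import boolp classical_sets cardinality.

Set Implicit Arguments.
Unset Strict Implicit.
Unset Printing Implicit Defensive.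

Local Open Scope classical_set_scope.
Local Open Scope quotient_scope.
Local Open Scope group_scope.

(* Group words over V: the letter (v, false) stands for the generator v, and
   (v, true) for its formal inverse. *)
Definition gword (V : Type) := seq (V * bool).

Definition gword_inv V (w : gword V) : gword V :=
  rev [seq (l.1, ~~ l.2) | l <- w].

Definition gword_eval (V : Type) (G : groupType) (f : V -> G) (w : gword V) : G :=
  \prod_(l <- w) (if l.2 then (f l.1)^-1 else f l.1).

Section Presentation.
Variables (V : choiceType) (R : set (gword V)).

(* The congruence on words whose quotient is the free group on V modulo the
   normal closure of the relators R. *)
Inductive pres_eq : gword V -> gword V -> Prop :=
| pres_refl w : pres_eq w w
| pres_sym w1 w2 : pres_eq w1 w2 -> pres_eq w2 w1
| pres_trans w1 w2 w3 : pres_eq w1 w2 -> pres_eq w2 w3 -> pres_eq w1 w3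
| pres_cat u1 u2 w1 w2 :
    pres_eq u1 u2 -> pres_eq w1 w2 -> pres_eq (u1 ++ w1) (u2 ++ w2)
| pres_cancel v b : pres_eq [:: (v, b); (v, ~~ b)] [::]
| pres_relator r : R r -> pres_eq r [::].

Definition pres_eqb : rel (gword V) := fun w1 w2 => `[< pres_eq w1 w2 >].

Lemma pres_eqb_equiv : equiv_class_of pres_eqb.
Proof.
split=> [w|w1 w2|w2 w1 w3]; first exact/asboolP/pres_refl.
  by apply/asboolP/asboolP; apply: pres_sym.
by move=> /asboolP h1 /asboolP h2; apply/asboolP/(pres_trans h1).
Qed.

Canonical pres_equiv := EquivRelPack pres_eqb_equiv.

Definition presented := {eq_quot pres_eqb}.

HB.instance Definition _ := Choice.on presented.
HB.instance Definition _ := EqQuotient.on presented.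

Definition pres_class (w : gword V) : presented := \pi w.

Definition pres_gen (v : V) : presented := pres_class [:: (v, false)].

Lemma pres_classP w1 w2 : pres_class w1 = pres_class w2 <-> pres_eq w1 w2.
Proof.
split=> [/eqP|h]; first by rewrite /pres_class eqmodE => /asboolP.
by apply/eqP; rewrite /pres_class eqmodE; apply/asboolP.
Qed.

Lemma pres_repr (w : gword V) : pres_eq (repr (pres_class w)) w.
Proof. by apply/pres_classP; rewrite /pres_class reprK. Qed.

Definition pres_one : presented := pres_class [::].
Definition pres_mul (x y : presented) : presented :=
  pres_class (repr x ++ repr y).
Definition pres_inv (x : presented) : presented :=
  pres_class (gword_inv (repr x)).

Lemma pres_mulE w1 w2 :
  pres_mul (pres_class w1) (pres_class w2) = pres_class (w1 ++ w2).
Proof. by apply/pres_classP/pres_cat; apply: pres_repr. Qed.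

Lemma pres_classK x : pres_class (repr x) = x.
Proof. exact: reprK. Qed.

Lemma pres_mulA : associative pres_mul.
Proof.
move=> x y z; rewrite -[x]pres_classK -[y]pres_classK -[z]pres_classK.
by rewrite !pres_mulE catA.
Qed.

Lemma pres_mul1 : left_id pres_one pres_mul.
Proof. by move=> x; rewrite -[x]pres_classK pres_mulE. Qed.

Lemma pres_mulx1 : right_id pres_one pres_mul.
Proof. by move=> x; rewrite -[x]pres_classK pres_mulE cats0. Qed.

Lemma gword_invK : involutive (@gword_inv V).
Proof.
move=> w; rewrite /gword_inv map_rev revK -map_comp -[RHS]map_id.
by apply: eq_map => -[v b] /=; rewrite negbK.
Qed.

Lemma pres_invr w : pres_eq (w ++ gword_inv w) [::].
Proof.
elim: w => [|[v b] w IHw]; first exact: pres_refl.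
have -> : ((v, b) :: w) ++ gword_inv ((v, b) :: w) =
          [:: (v, b)] ++ (w ++ gword_inv w) ++ [:: (v, ~~ b)].
  by rewrite /gword_inv /= rev_cons -cats1 !catA.
apply: pres_trans _ (pres_cancel v b).
rewrite -[X in pres_eq _ X]/([:: (v, b)] ++ [::] ++ [:: (v, ~~ b)]).
apply: pres_cat; first exact: pres_refl.
exact: pres_cat IHw (pres_refl _).
Qed.

Lemma pres_mulxV : right_inverse pres_one pres_inv pres_mul.
Proof.
by move=> x; rewrite -{1}[x]pres_classK pres_mulE; apply/pres_classP/pres_invr.
Qed.

Lemma pres_mulVx : left_inverse pres_one pres_inv pres_mul.
Proof.
move=> x; rewrite -{2}[x]pres_classK pres_mulE; apply/pres_classP.
by rewrite -{2}[repr x]gword_invK; apply: pres_invr.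
Qed.

HB.instance Definition _ := isGroup.Build presented
  pres_mulA pres_mul1 pres_mulx1 pres_mulVx pres_mulxV.

Lemma pres_class_eval w : pres_class w = gword_eval pres_gen w.
Proof.
elim: w => [|[v b] w IHw]; first by rewrite /gword_eval big_nil.
rewrite /gword_eval big_cons -/(gword_eval pres_gen w) -IHw -cat1s -pres_mulE.
congr (_ * _); case: b => //=.
apply: (@mulgI _ (pres_gen v)); rewrite mulgV.
by rewrite [LHS]pres_mulE; apply/pres_classP/(pres_cancel v false).
Qed.

(* Universal property of the presentation. *)
Lemma presented_univ (G : groupType) (f : V -> G) :
  (forall r, R r -> gword_eval f r = 1) ->
  exists! h : presented -> G,
    (forall x y, h (x * y) = h x * h y) /\ (forall v, h (pres_gen v) = f v).
Proof.
move=> fR.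
have ev_cat w1 w2 : gword_eval f (w1 ++ w2) = gword_eval f w1 * gword_eval f w2.
  by rewrite /gword_eval big_cat.
have ev w1 w2 : pres_eq w1 w2 -> gword_eval f w1 = gword_eval f w2.
  elim=> //= [u1 u2 u3 _ -> _ -> //|u1 u2 v1 v2 _ e1 _ e2|v b|r /fR ->].
  - by rewrite !ev_cat e1 e2.
  - rewrite /gword_eval !big_cons !big_nil mulg1 /=.
    by case: b => /=; rewrite ?mulgV ?mulVg.
  - by rewrite /gword_eval big_nil.
pose h (x : presented) := gword_eval f (repr x).
have hE w : h (pres_class w) = gword_eval f w by apply/ev/pres_repr.
have hg v : h (pres_gen v) = f v.
  by rewrite hE /gword_eval big_cons big_nil mulg1.
exists h; split; first by split=> // x y; rewrite [LHS]hE ev_cat.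
move=> k [kM kg]; apply/funext => x; rewrite -[x]pres_classK hE.
have k1 : k 1 = 1 by apply: (@mulgI _ (k 1)); rewrite -kM !mulg1.
have kV y : k y^-1 = (k y)^-1.
  by apply: (@mulgI _ (k y)); rewrite -kM !mulgV.
elim: (repr x) => [|[v b] w IHw]; first by rewrite /gword_eval big_nil -k1.
rewrite pres_class_eval /gword_eval !big_cons kM.
rewrite -/(gword_eval f w) -/(gword_eval pres_gen w) IHw -pres_class_eval.
by case: b => /=; rewrite ?kV kg.
Qed.

End Presentation.

(* Edges are unordered pairs, hence for a symmetric E both (vw)^2 and (wv)^2
   are listed; they are conjugate, so the presented group is unaffected. *)
Definition racg_relators (V : finType) (E : rel V) : set (gword V) :=
  [set [:: (v, false); (v, false)] | v in [set: V]] `|`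
  [set r | exists v w, E v w /\
     r = [:: (v, false); (w, false); (v, false); (w, false)]].

Definition racg (V : finType) (E : rel V) : groupType :=
  presented (racg_relators E).

Definition has_order (G : groupType) (x : G) (n : nat) : Prop :=
  [/\ (0 < n)%N, x ^+ n = 1 & forall m, (0 < m < n)%N -> x ^+ m <> 1].

Definition involution (G : groupType) (x : G) : Prop := has_order x 2.

Definition conj_class (G : groupType) (x : G) : set G :=
  [set x ^ g | g in [set: G]].

Definition involution_classes (G : groupType) : set (set G) :=
  [set conj_class x | x in @involution G].

Arguments involution_classes : clear implicits.

(* A complete subgraph is determined by its vertex set. *)
Definition clique (V : finType) (E : rel V) (A : {set V}) : bool :=
  [forall x in A, forall y in A, (x != y) ==> E x y].

Definition num_nontrivial_cliques (V : finType) (E : rel V) : nat :=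
  #|[pred A : {set V} | clique E A & (0 < #|A|)%N]|.

(* Main.v *)
(* The group acts on functions V -> int by the dual geometric representation.
   Following the constant function 1 shows, through the positivity of roots, that
   a nonempty word representing 1 contains two occurrences of a letter s
   separated only by letters adjacent to s.  Apply this to w w, where w is a
   reduced word representing an involution: some s can be moved both to the head
   and to the tail of w.  Either these are two occurrences, and conjugating by s
   shortens w, or there is a single one, s is adjacent to all other letters, and
   one recurses on w with s deleted.  Hence w is conjugate, by a word in its own
   letters, to the product of a clique.  Distinct cliques are separated by the
   parities of the numbers of occurrences of the letters, which are conjugation
   invariant. *)
Require Import Defs.
From mathcomp Require Import all_boot.
From mathcomp Require Import boolp classical_sets cardinality.
From mathcomp Require Import ssralg ssrnum ssrint zify.

Set Implicit Arguments.
Unset Strict Implicit.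
Unset Printing Implicit Defensive.

Import GRing.Theory Num.Theory.

(** * Combinatorics of commutation and cancellation in words *)

Section ReducedWords.
Variables (V : finType) (E : rel V).
Hypotheses (E_sym : symmetric E) (E_irr : irreflexive E).
Implicit Types (s t u v : V) (w : seq V).

(* s has an occurrence in w that can be moved to the head by commutations. *)
Fixpoint front s w : bool :=
  if w is t :: w' then (s == t) || (E s t && front s w') else false.

Fixpoint reduced w : bool :=
  if w is t :: w' then ~~ front t w' && reduced w' else true.

Lemma adj_neq s t : E s t -> s != t.
Proof. by apply: contraTneq => ->; rewrite E_irr. Qed.

Lemma front_mem s w : front s w -> s \in w.
Proof.
elim: w => //= t w IH; rewrite inE => /orP[->//|/andP[_ /IH ->]].
exact: orbT.
Qed.

Lemma front_cat s w1 w2 :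
  front s (w1 ++ w2) = front s w1 || (all (E s) w1 && front s w2).
Proof.
elim: w1 => //= t w1 ->.
by case: eqP => //= _; case: (E s t).
Qed.

Lemma front_rem s t w : E s t -> front s (rem t w) -> front s w.
Proof.
move=> Est; elim: w => //= u w IH; case: eqP => [-> ->|_ /=].
  by rewrite Est orbT.
by case/orP=> [->//|/andP[-> /IH ->]]; rewrite orbT.
Qed.

Lemma reduced_rem t w : reduced w -> front t w -> reduced (rem t w).
Proof.
elim: w => //= u w IH /andP[nuw rw]; case: eqVneq => //= _ /andP[Etu fw].
rewrite IH // andbT; apply: contra nuw; apply: front_rem.
by rewrite E_sym.
Qed.

Lemma front_rem_reduced t w : reduced w -> front t w -> ~~ front t (rem t w).
Proof.
elim: w => //= u w IH /andP[nuw rw]; case: eqVneq => [-> //|ntu] /= /andP[Etu fw].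
by rewrite (negbTE ntu) Etu IH.
Qed.

(** Two occurrences that cancel must straddle the cut, so their letter reaches the tail of [w1] and
    the head of [w2]. *)
Lemma nonreduced_cat w1 w2 : reduced w1 -> reduced w2 -> ~~ reduced (w1 ++ w2) ->
  exists2 s, front s (rev w1) & front s w2.
Proof.
elim: w1 => [|t w1 IH] /=; first by move=> _ ->.
move=> /andP[nt r1] r2; rewrite negb_and negbK rev_cons -cats1 => /orP[].
  rewrite front_cat (negbTE nt) => /andP[a1 f2].
  by exists t; rewrite // front_cat all_rev a1 /= eqxx orbT.
by case/(IH r1 r2) => s f1 f2; exists s; rewrite // front_cat f1.
Qed.

(** * The dual geometric representation *)

(* Dual of the reflection in s for the form B with B(s,s) = 1 and, for t <> s,
   B(s,t) = 0 if E s t and B(s,t) = -1 otherwise. *)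
Definition refl s (f : V -> int) : V -> int := fun t =>
  if t == s then (- f s)%R else if E s t then f t else (f t + f s *+ 2)%R.

Definition act w f := foldr refl f w.

Lemma reflK s f : refl s (refl s f) = f.
Proof.
apply/funext => t; rewrite /refl eqxx.
by case: eqVneq => [->|_]; last case: (E s t) => //; lia.
Qed.

Lemma reflC s t f : E s t -> refl s (refl t f) = refl t (refl s f).
Proof.
move=> Est; have Ets : E t s by rewrite E_sym.
have nst := adj_neq Est; have nts : t != s by rewrite eq_sym.
apply/funext => u; rewrite /refl (negbTE nst) (negbTE nts) Est Ets.
have [->|nus] := eqVneq u s; first by rewrite (negbTE nst) Ets.
have [->|nut] := eqVneq u t; first by rewrite Est.
by case: (E s u); case: (E t u); lia.
Qed.

Lemma act_front s w f : front s w -> act w f = refl s (act (rem s w) f).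
Proof.
elim: w => //= t w IH; rewrite [t == s]eq_sym.
case: eqVneq => [->//|_] /= /andP[Est fw].
by rewrite IH // reflC // E_sym.
Qed.

(* The forms [m f(t) + (m+1) f(s)] are positive roots of the infinite dihedral
   group generated by s and t; stripping a t from the front of w exchanges s and
   t and replaces m by m + 1. *)
Lemma act_dihedral_gt0 n :
  (forall w s, (size w < n)%N -> reduced w -> ~~ front s w ->
     (0 < act w (fun=> 1) s)%R) ->
  forall w s t m, (size w < n)%N -> reduced w -> ~~ front s w ->
    s != t -> ~~ E s t ->
    (0 < act w (fun=> 1) t *+ m + act w (fun=> 1) s *+ m.+1)%R.
Proof.
move=> pos w; have [k le_wk] := ubnP (size w).
elim: k w le_wk => // k IH w le_wk s t m le_wn rw nsw nst nEst.
have [ftw|ntw] := boolP (front t w); last first.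
  by move: (pos w s le_wn rw nsw) (pos w t le_wn rw ntw); nia.
have lt_rem : (size (rem t w) < size w)%N.
  by rewrite size_rem ?front_mem // prednK //; case: (w) ftw.
have nsr : ~~ E t s by rewrite E_sym.
move: (IH (rem t w) (leq_trans lt_rem le_wk) t s m.+1).
rewrite (act_front _ ftw) /refl eqxx (negbTE nst) (negbTE nsr).
move=> /(_ (ltn_trans lt_rem le_wn) (reduced_rem rw ftw)).
rewrite front_rem_reduced // eq_sym nst => /(_ isT isT isT).
by nia.
Qed.

Lemma act_gt0 w s : reduced w -> ~~ front s w -> (0 < act w (fun=> 1) s)%R.
Proof.
have [n] := ubnP (size w); elim: n w s => // n IH [|t w] s //= le_wn.
case/andP=> ntw rw; rewrite negb_or negb_and /refl => /andP[nst].
rewrite (negbTE nst) [E t s]E_sym.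
case: (boolP (E s t)) => /= [_ nsw|nEst _]; first exact: IH.
have nEts : ~~ E t s by rewrite E_sym.
have nts : t != s by rewrite eq_sym.
(* With [m = 1] the form is [f(s) + 2 f(t)], the value at [s] after reflecting in [t]. *)
have /(_ w t s 1%N le_wn rw ntw nts nEts) := act_dihedral_gt0 IH.
by rewrite mulr1n.
Qed.

(** A head letter [s] negates a positive value, so a nonempty reduced word moves the constant
    function 1. *)
Lemma act_eq1_reduced w :
  act w (fun=> 1%R) = (fun=> 1%R) -> reduced w -> w = [::].
Proof.
case: w => //= s w eq1 /andP[nsw rw].
have := act_gt0 rw nsw; have := congr1 (@^~ s) eq1.
by rewrite /refl eqxx; lia.
Qed.

End ReducedWords.

Local Open Scope classical_set_scope.
Local Open Scope group_scope.

(** * Words evaluated in the Coxeter group *)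

Section Racg.
Variables (V : finType) (E : rel V).
Hypotheses (E_sym : symmetric E) (E_irr : irreflexive E).
Local Notation W := (racg E).
Local Notation front := (front E).
Local Notation reduced := (reduced E).
Implicit Types (s t u v : V) (w c : seq V).

Definition gen v : W := pres_gen (racg_relators E) v.
Definition ev w : W := \prod_(v <- w) gen v.

Lemma ev_nil : ev [::] = 1. Proof. exact: big_nil. Qed.
Lemma ev_cons v w : ev (v :: w) = gen v * ev w. Proof. exact: big_cons. Qed.
Lemma ev_cat w1 w2 : ev (w1 ++ w2) = ev w1 * ev w2.
Proof. exact: big_cat. Qed.

Lemma genK v : gen v * gen v = 1.
Proof.
rewrite [LHS]pres_mulE; apply/pres_classP/pres_relator.
by left; exists v.
Qed.

Lemma genV v : (gen v)^-1 = gen v.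
Proof. by apply: (mulgI (gen v)); rewrite mulgV genK. Qed.

Lemma ev_class w : ev w = pres_class _ [seq (v, false) | v <- w].
Proof. by rewrite pres_class_eval /gword_eval big_map. Qed.

Lemma genC s t : E s t -> gen s * gen t = gen t * gen s.
Proof.
move=> Est; have e : gen s * gen t * (gen s * gen t) = 1.
  have <- : ev [:: s; t; s; t] = 1.
    by rewrite ev_class; apply/pres_classP/pres_relator; right; exists s, t.
  by rewrite !ev_cons ev_nil mulg1 !mulgA.
apply: (mulgI (gen s * gen t)); rewrite e.
by rewrite mulgA -(mulgA (gen s)) genK mulg1 genK.
Qed.

Lemma ev_surj (x : W) : exists w, x = ev w.
Proof.
exists [seq l.1 | l <- repr x]; rewrite -[LHS]pres_classK pres_class_eval.
rewrite /ev big_map; apply: eq_bigr => -[v []] //= _.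
exact: genV.
Qed.

(** Involutions of [T] that commute along edges define an action of the group. Induction on the
    congruence avoids building a permutation group of [T]. *)
Lemma ev_foldr (T : Type) (a : V -> T -> T) :
    (forall v, involutive (a v)) ->
    (forall s t, E s t -> forall x, a s (a t x) = a t (a s x)) ->
  forall w1 w2, ev w1 = ev w2 -> forall x, foldr a x w1 = foldr a x w2.
Proof.
move=> aK aC w1 w2; rewrite !ev_class => /pres_classP eq_w x.
(* The sign is dropped because each [a v] is its own inverse. *)
pose b (l : V * bool) := a l.1.
have fE w : foldr a x w = foldr b x [seq (v, false) | v <- w].
  by elim: w => //= v w ->.
rewrite !fE; move: eq_w; move: (map _ _) (map _ _) => u1 u2 eq_u.
elim: eq_u x {fE} => //.
- by move=> y1 y2 y3 _ e1 _ e2 x; rewrite e1.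
- by move=> y1 y2 z1 z2 _ e1 _ e2 x; rewrite !foldr_cat e2 e1.
- by move=> v c x /=; rewrite /b /= aK.
- move=> r [[v _ <-]|[s [t [Est ->]]]] x; rewrite /b /= ?aK //.
  by rewrite (aC s t) // aK aK.
Qed.

(** The group acts on [bool]: [u] negates and the other letters act trivially. *)
Lemma ev_odd_count w1 w2 u :
  ev w1 = ev w2 -> odd (count_mem u w1) = odd (count_mem u w2).
Proof.
have oddE w : odd (count_mem u w) = foldr (fun v b => (v == u) (+) b) false w.
  by elim: w => //= v w <-; rewrite oddD oddb.
move=> eq_w; rewrite !oddE; apply: ev_foldr => // [v b|s t _ b].
  by rewrite addKb.
by rewrite addbCA.
Qed.

Lemma ev1_reduced w : ev w = 1 -> reduced w -> w = [::].
Proof.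
rewrite -ev_nil => ew; apply: (act_eq1_reduced E_sym E_irr).
have reflC' s t : E s t -> forall f, refl E s (refl E t f) = refl E t (refl E s f).
  by move=> Est f; apply: reflC.
exact: (ev_foldr (reflK E) reflC' ew).
Qed.

Lemma ev_front s w : front s w -> ev w = gen s * ev (rem s w).
Proof.
elim: w => //= t w IH; rewrite [t == s]eq_sym.
case: eqVneq => [->|_] /=; first by rewrite ev_cons.
by case/andP=> Est fw; rewrite !ev_cons IH // !mulgA (genC Est).
Qed.

Lemma ev_rev w : ev (rev w) = (ev w)^-1.
Proof.
elim: w => [|v w IH]; first by rewrite ev_nil invg1.
by rewrite rev_cons -cats1 ev_cat IH !ev_cons ev_nil mulg1 invgM genV.
Qed.

Lemma ev_back s w : front s (rev w) ->
  ev w = ev (rev (rem s (rev w))) * gen s.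
Proof.
by move=> /ev_front e; rewrite -[LHS]invgK -ev_rev e invgM genV ev_rev.
Qed.

Lemma ev_comm s w : all (E s) w -> gen s * ev w = ev w * gen s.
Proof.
elim: w => [|v w IH] /=; first by rewrite ev_nil mulg1 mul1g.
by case/andP=> Esv /IH e; rewrite ev_cons mulgA genC // -!mulgA e.
Qed.

Lemma nonreduced_shorten w : ~~ reduced w ->
  exists w', [/\ (size w' < size w)%N, {subset w' <= w} & ev w' = ev w].
Proof.
elim: w => //= t w IH; rewrite negb_and negbK => /orP[fw|/IH].
  exists (rem t w); split.
  - by rewrite size_rem ?(front_mem fw) // ltnS leq_pred.
  - by move=> v /mem_rem; rewrite inE orbC => ->.
  - by rewrite ev_cons (ev_front fw) mulgA genK mul1g.
case=> w' [lt_w' sub_w' ew']; exists (t :: w'); split => //.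
- by move=> v; rewrite !inE => /orP[->//|/sub_w' ->]; rewrite orbT.
- by rewrite !ev_cons ew'.
Qed.

(** * Elements of square 1 and products of cliques *)

Lemma ev_clique_sq c : pairwise E c -> ev c * ev c = 1.
Proof.
elim: c => [|s c IH] /=; first by rewrite ev_nil mulg1.
case/andP=> sc cc; rewrite ev_cons {1}ev_comm // -mulgA (mulgA (gen s)) genK.
by rewrite mul1g IH.
Qed.

(** Cut [w] as [p ++ s :: q] at the occurrence that moves to the head. Either an [s] inside [q]
    moves to the tail, or [s] is adjacent to all of [q] as well as [p]. *)
Lemma front_back_cases s w : front s w -> front s (rev w) ->
  front s (rev (rem s w)) \/ all (E s) (rem s w).
Proof.
move=> fw; have [p [q [-> Ep ->]]] : exists p q,
    [/\ w = p ++ s :: q, all (E s) p & rem s w = p ++ q].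
  elim: w fw => //= t w IH; rewrite [t == s]eq_sym.
  case: eqVneq => [<- _|_ /= /andP[Est /IH [p [q [ew Ep er]]]]].
    by exists [::], w.
  by exists (t :: p), q; rewrite er /= Est Ep ew.
rewrite !rev_cat rev_cons -cats1 -catA !front_cat => /orP[->|/andP[Eq _]].
  by left.
by right; rewrite all_cat Ep -all_rev.
Qed.

(** The inclusions carry the induction: if [s] is adjacent to all remaining letters, it commutes
    with [g] and extends the clique [c]. *)
Lemma ev_sq1_conj_clique w : ev w * ev w = 1 ->
  exists g c, [/\ pairwise E c, {subset g <= w}, {subset c <= w} &
                  ev w = ev g * ev c * (ev g)^-1].
Proof.
have [n] := ubnP (size w); elim: n w => // n IH w le_wn w2.
have [rw|/nonreduced_shorten[w' [lt_w' sub_w' ew']]] := boolP (reduced w); last first.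
  have [|g [c [cc sg sc e]]] := IH w' (leq_trans lt_w' le_wn); first by rewrite ew'.
  by exists g, c; split; rewrite -?ew' // => v; [move/sg | move/sc]; apply: sub_w'.
have [->|w_neq0] := eqVneq w [::].
  by exists [::], [::]; split; rewrite // ev_nil invg1 !mulg1.
have [s bs fs] : exists2 s, front s (rev w) & front s w.
  (* A reduced [w ++ w] would be empty, since its value is 1. *)
  apply: nonreduced_cat => //; apply: contra w_neq0 => rww.
  move: (ev1_reduced (etrans (ev_cat w w) w2) rww).
  by case: (w).
have size_fs x y : front x y -> (size (rem x y) < size y)%N.
  by move=> fxy; rewrite size_rem ?(front_mem fxy) // prednK //; case: (y) fxy.
set w1 := rem s w; have sub_w1 : {subset w1 <= w} by apply: mem_rem.
have e1 : ev w = gen s * ev w1 := ev_front fs.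
have lt_w1 : (size w1 < n)%N by apply: leq_trans (size_fs _ _ fs) le_wn.
have [b1|Esw1] := front_back_cases fs bs.
(* Now [w] and [s w3 s] have the same value. *)
- have e2 := ev_back b1; set w3 := rev _ in e2.
  have sub_w3 : {subset w3 <= w}.
    by move=> v; rewrite mem_rev => /mem_rem; rewrite mem_rev => /sub_w1.
  have lt_w3 : (size w3 < n)%N.
    rewrite size_rev; apply: ltn_trans (size_fs _ _ b1) _.
    by rewrite size_rev.
  have w3_sq : ev w3 * ev w3 = 1.
    apply: (mulgI (gen s)); apply: (mulIg (gen s)); rewrite mulg1 genK -w2.
    by rewrite e1 e2 -!mulgA (mulgA (gen s) (gen s)) genK mul1g.
  have [g [c [cc sg sc e]]] := IH w3 lt_w3 w3_sq.
  exists (s :: g), c; split=> //.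
  + by move=> v; rewrite inE => /orP[/eqP->|/sg/sub_w3 //]; apply: front_mem fs.
  + by move=> v /sc /sub_w3.
  + by rewrite e1 e2 e ev_cons invgM genV !mulgA.
- have w1_sq : ev w1 * ev w1 = 1.
    by rewrite -w2 e1 {1}ev_comm // -mulgA (mulgA (gen s)) genK mul1g.
  have [g [c [cc sg sc e]]] := IH w1 lt_w1 w1_sq.
  exists g, (s :: c); split.
  + by rewrite /= cc andbT; apply/allP => v /sc; apply: (allP Esw1).
  + by move=> v /sg /sub_w1.
  + by move=> v; rewrite inE => /orP[/eqP->|/sc/sub_w1 //]; apply: front_mem fs.
  + rewrite e1 e ev_cons !mulgA ev_comm //.
    by apply/allP => v /sg; apply: (allP Esw1).
Qed.

(** Every letter of a clique can be moved to the head. This allows passing from a list to the [enum]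
    of its set. *)
Lemma ev_clique_perm c d : pairwise E c -> perm_eq c d -> ev c = ev d.
Proof.
elim: d c => [|s d IH] c cc cd; first by move/perm_nilP: cd => ->.
have sc : s \in c by rewrite (perm_mem cd) mem_head.
have fs : front s c.
  elim: c cc sc {cd} => //= t c IHc /andP[tc cc]; rewrite inE.
  case: eqP => //= _ sc; rewrite IHc // andbT E_sym.
  exact: (allP tc).
rewrite (ev_front fs) ev_cons (IH (rem s c)) //.
  exact: subseq_pairwise (rem_subseq _ _) cc.
by rewrite -(perm_cons s) perm_sym -(permPl cd) perm_to_rem.
Qed.

Lemma pairwise_adj_uniq c : pairwise E c -> uniq c.
Proof.
elim: c => //= s c IH /andP[sc /IH ->]; rewrite andbT.
by apply/negP => /(allP sc); rewrite E_irr.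
Qed.

Lemma clique_pairwise (A : {set V}) : clique E A -> pairwise E (enum A).
Proof.
move=> /forall_inP cA.
have : {subset enum A <= A} by move=> v; rewrite mem_enum.
elim: (enum A) (enum_uniq A) => //= s c IH /andP[sc uc] sub.
rewrite IH // ?andbT => [|v vc]; last by apply: sub; rewrite inE vc orbT.
apply/allP => v vc.
have /forall_inP/(_ v) := cA s (sub s (mem_head _ _)).
rewrite sub ?inE ?vc ?orbT // => /(_ isT)/implyP; apply.
by apply: contraNneq sc => ->.
Qed.

Lemma pairwise_clique c : pairwise E c -> clique E [set v in c].
Proof.
move=> cc; apply/forall_inP => x /[!inE] xc; apply/forall_inP => y /[!inE] yc.
apply/implyP; elim: c cc xc yc => //= s c IH /andP[sc cc]; rewrite !inE.
case/orP=> [/eqP->|xc] /orP[/eqP->|yc]; rewrite ?eqxx // => nxy.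
- exact: (allP sc).
- by rewrite E_sym; apply: (allP sc).
- exact: IH.
Qed.

(** * Conjugacy classes of clique products *)

Definition clique_class (A : {set V}) : set W := conj_class (ev (enum A)).

Lemma clique_class_inj : injective clique_class.
Proof.
move=> A B eqAB; have : clique_class A (ev (enum A)).
  by exists 1; rewrite ?conjg1.
rewrite eqAB => -[g _]; have [h ->] := ev_surj g.
rewrite conjgE -ev_rev -!ev_cat => /ev_odd_count eAB.
apply/setP => v; move: (eAB v); rewrite !count_cat count_rev.
(* The conjugating word and its reverse contribute an even count of [v]. *)
rewrite addnCA oddD addnn odd_double addbF.
by rewrite !count_uniq_mem ?enum_uniq // !oddb !mem_enum.
Qed.

Lemma involutionP (G : groupType) (x : G) :
  involution x <-> x * x = 1 /\ x <> 1.
Proof.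
split=> [[_ x2 x1]|[x2 x1]].
  by split; [rewrite -expg2 | have := x1 1%N isT; rewrite expg1].
split=> //.
by case=> [|[|m]] // _; rewrite expg1.
Qed.

Lemma clique_class_involution A : clique E A -> (0 < #|A|)%N ->
  involution (ev (enum A)).
Proof.
move=> cA /card_gt0P[v vA]; apply/involutionP; split.
  exact/ev_clique_sq/clique_pairwise.
(* The letter [v] occurs once in [enum A], but an even number of times in any word for 1. *)
rewrite -ev_nil => /(ev_odd_count v).
by rewrite count_uniq_mem ?enum_uniq // mem_enum vA.
Qed.

Lemma conj_classJ (G : groupType) (x g : G) : conj_class (x ^ g) = conj_class x.
Proof.
apply/seteqP; split=> _ [h _ <-]; first by exists (g * h); rewrite ?conjgM.
by exists (g^-1 * h); rewrite ?conjgM ?conjgK.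
Qed.

Lemma involution_clique_class (x : W) : involution x ->
  exists A, [/\ clique E A, (0 < #|A|)%N & conj_class x = clique_class A].
Proof.
move=> /involutionP[x2 x1]; have [w xw] := ev_surj x.
have [|g [c [cc _ _ e]]] := @ev_sq1_conj_clique w; first by rewrite -xw.
have pc : perm_eq c (enum [set v in c]).
  apply: uniq_perm; rewrite ?enum_uniq ?pairwise_adj_uniq // => v.
  by rewrite mem_enum inE.
exists [set v in c]; split; first exact: pairwise_clique.
  rewrite cardE -(perm_size pc); case: c {cc pc} e => // e; case: x1.
  by rewrite xw e ev_nil mulg1 mulgV.
rewrite /clique_class -(ev_clique_perm cc pc).
have -> : x = ev c ^ (ev g)^-1 by rewrite conjgE invgK xw e mulgA.
exact: conj_classJ.
Qed.

End Racg.

Theorem proposition5p2 (V : finType) (E : rel V)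
    (E_sym : symmetric E) (E_irr : irreflexive E) :
  (involution_classes (racg E) #= `I_(num_nontrivial_cliques E))%card.
Proof.
pose P := [pred A : {set V} | clique E A & (0 < #|A|)%N].
(* Only indices below the size of [enum P] matter, so the default [finset.set0] is never reached. *)
pose F i := @clique_class V E (nth finset.set0 (enum P) i).
have -> : involution_classes (racg E) = F @` `I_(num_nontrivial_cliques E).
  apply/seteqP; split=> [_ [x xinv <-]|_ [i lt_i <-]].
    have [A [cA A0 ->]] := involution_clique_class E_sym E_irr xinv.
    have AP : A \in enum P by rewrite mem_enum inE cA.
    exists (index A (enum P)); last by rewrite /F nth_index.
    by rewrite /= /num_nontrivial_cliques cardE index_mem.
  have : nth finset.set0 (enum P) i \in enum P by rewrite mem_nth // -cardE.
  rewrite mem_enum => /andP[cA A0].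
  exists (@ev V E (enum (nth finset.set0 (enum P) i))) => //.
  exact: clique_class_involution.
apply: inj_card_eq => i j /[!inE] lt_i lt_j /clique_class_inj/eqP.
by rewrite nth_uniq ?enum_uniq -?cardE // => /eqP.
Qed.
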